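(* The following complex is a 4-periodic free resolution of the trivial module $\mathbb{Z}$ over $\mathbb{Z}[\mathcal{T}]$, where $\mathcal{T}$ is the binary tetrahedral group: $$\cdots\to \mathbb{Z}[\mathcal{T}]^4\xrightarrow{\partial_{4q-3}}\mathbb{Z}[\mathcal{T}]\xrightarrow{\partial_{4q-4}}\cdots\to\mathbb{Z}[\mathcal{T}]^4\xrightarrow{\partial_2}\mathbb{Z}[\mathcal{T}]^4\xrightarrow{\partial_1}\mathbb{Z}[\mathcal{T}]\xrightarrow{\varepsilon}\mathbb{Z}\to0,$$ whose term in degree $m\ge0$ is $\mathbb{Z}[\mathcal{T}]$ if $m\equiv0,3\pmod4$ and $\mathbb{Z}[\mathcal{T}]^4$ if $m\equiv1,2\pmod4$, where $\varepsilon$ is the augmentation and, for $q\ge1$, $$\partial_{4q-3}=\begin{pmatrix}\omega_{ij}-1 \\ \omega_j-1 \\ \omega_0-1 \\ \omega_i-1\end{pmatrix},\quad\partial_{4q-2}=\begin{pmatrix}\omega_0 & -1 & 1 & 0 \\ 0 & \omega_i & -1 & 1 \\ 1 & 0 & \omega_{ij} & -1 \\ -1 & 1 & 0 & \omega_j\end{pmatrix},$$ $$\partial_{4q-1}=\begin{pmatrix}1-\omega_{ij} & 1-\omega_j & 1-\omega_0 & 1-\omega_i\end{pmatrix},\quad\partial_{4q}=\begin{pmatrix}\sum_{g\in\mathcal{T}}g\end{pmatrix}.$$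
   Context: $\mathcal{T}$ is the subgroup of order 24 of the group of unit quaternions generated by $i$ and $\frac12(-1+i+j+k)$. Put $\omega_0=\frac{1+i+j+k}{2}$, $\omega_i=\frac{1-i+j+k}{2}$, $\omega_j=\frac{1+i-j+k}{2}$, $\omega_{ij}=\frac{1-i-j+k}{2}$; all lie in $\mathcal{T}$. In the matrices, sums and differences are taken in the group ring $\mathbb{Z}[\mathcal{T}]$ and $\pm1$ means $\pm$ its unit. The augmentation is $\varepsilon(\sum_ga_gg)=\sum_ga_g$. Modules are left modules; a homomorphism $\mathbb{Z}[\mathcal{T}]^m\to\mathbb{Z}[\mathcal{T}]^n$ is given by an $m\times n$ matrix acting on row vectors by right multiplication. *)

(* Defs.v *)
From HB Require Import structures.
From mathcomp Require Import all_boot all_order all_fingroup all_algebra.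
From mathcomp Require Import ring.
From mathcomp Require Import boolp classical_sets reals.

Set Implicit Arguments.
Unset Strict Implicit.
Unset Printing Implicit Defensive.

Import Order.TTheory GRing.Theory Num.Theory.
Local Open Scope ring_scope.

(* [Quat a b c d] is a + b i + c j + d k. *)
Record quat (R : realFieldType) := Quat { qre : R; qi : R; qj : R; qk : R }.

Section Quaternions.
Variable R : realFieldType.
Implicit Types x y : quat R.

Definition quat_tuple x := (qre x, qi x, qj x, qk x).
Definition tuple_quat (t : R * R * R * R) :=
  let: (a, b, c, d) := t in Quat a b c d.
Lemma quat_tupleK : cancel quat_tuple tuple_quat.
Proof. by case. Qed.
HB.instance Definition _ := Choice.copy (quat R) (can_type quat_tupleK).

Definition qadd x y :=
  Quat (qre x + qre y) (qi x + qi y) (qj x + qj y) (qk x + qk y).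
Definition qopp x := Quat (- qre x) (- qi x) (- qj x) (- qk x).
Definition qmul x y :=
  Quat (qre x * qre y - qi x * qi y - qj x * qj y - qk x * qk y)
       (qre x * qi y + qi x * qre y + qj x * qk y - qk x * qj y)
       (qre x * qj y - qi x * qk y + qj x * qre y + qk x * qi y)
       (qre x * qk y + qi x * qj y - qj x * qi y + qk x * qre y).
Definition qscale (a : R) x := Quat (a * qre x) (a * qi x) (a * qj x) (a * qk x).
Definition conjq x := Quat (qre x) (- qi x) (- qj x) (- qk x).
Definition sqnormq x := qre x ^+ 2 + qi x ^+ 2 + qj x ^+ 2 + qk x ^+ 2.

Local Ltac quat_ring :=
  repeat case=> ? ? ? ?; rewrite /qadd /qopp /qmul /qscale /conjq /=;
  congr Quat; ring.

Lemma qaddA : associative qadd. Proof. by quat_ring. Qed.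
Lemma qaddC : commutative qadd. Proof. by quat_ring. Qed.
Lemma qadd0 : left_id (Quat 0 0 0 0) qadd. Proof. by quat_ring. Qed.
Lemma qaddN : left_inverse (Quat 0 0 0 0) qopp qadd. Proof. by quat_ring. Qed.
Lemma qmulA : associative qmul. Proof. by quat_ring. Qed.
Lemma qmul1l : left_id (Quat 1 0 0 0) qmul. Proof. by quat_ring. Qed.
Lemma qmul1 : right_id (Quat 1 0 0 0) qmul. Proof. by quat_ring. Qed.
Lemma qmulDl : left_distributive qmul qadd. Proof. by quat_ring. Qed.
Lemma qmulDr : right_distributive qmul qadd. Proof. by quat_ring. Qed.

HB.instance Definition _ :=
  GRing.isZmodule.Build (quat R) qaddA qaddC qadd0 qaddN.

Lemma qone_neq0 : Quat 1 0 0 0 != 0 :> quat R.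
Proof. by apply/eqP => -[] /eqP; rewrite oner_eq0. Qed.

HB.instance Definition _ := GRing.Zmodule_isNzRing.Build (quat R)
  qmulA qmul1l qmul1 qmulDl qmulDr qone_neq0.

Lemma qscaleA a b x : qscale a (qscale b x) = qscale (a * b) x.
Proof. by move: x; quat_ring. Qed.
Lemma qscale1 : left_id 1 qscale. Proof. by quat_ring. Qed.
Lemma qscaleDr : right_distributive qscale +%R.
Proof.
move=> a; change (forall x y,
  qscale a (qadd x y) = qadd (qscale a x) (qscale a y)); quat_ring.
Qed.
Lemma qscaleDl x : {morph qscale^~ x : a b / a + b}.
Proof.
move=> a b; move: x; change (forall x,
  qscale (a + b) x = qadd (qscale a x) (qscale b x)); quat_ring.
Qed.

HB.instance Definition _ :=
  GRing.Zmodule_isLmodule.Build R (quat R) qscaleA qscale1 qscaleDr qscaleDl.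

Lemma qmulE x y : x * y = qmul x y. Proof. by []. Qed.
Lemma qscaleE a x : a *: x = qscale a x. Proof. by []. Qed.
Lemma qaddE x y : x + y = qadd x y. Proof. by []. Qed.
Lemma qoppE x : - x = qopp x. Proof. by []. Qed.
Lemma qoneE : 1 = Quat 1 0 0 0 :> quat R. Proof. by []. Qed.
Definition quatE := (qmulE, qscaleE, qaddE, qoppE, qoneE).

Lemma sqnormqM x y : sqnormq (x * y) = sqnormq x * sqnormq y.
Proof. by case: x y => ? ? ? ? [? ? ? ?]; rewrite /sqnormq /=; ring. Qed.
Lemma sqnormq1 : sqnormq 1 = 1.
Proof. by rewrite /sqnormq /=; ring. Qed.
Lemma sqnorm_conjq x : sqnormq (conjq x) = sqnormq x.
Proof. by case: x => ? ? ? ?; rewrite /sqnormq /=; ring. Qed.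
Lemma mul_conjq x : conjq x * x = Quat (sqnormq x) 0 0 0.
Proof.
case: x => a b c d.
rewrite qmulE /qmul /sqnormq /=; congr Quat; ring.
Qed.
Lemma qmul_conj x : x * conjq x = Quat (sqnormq x) 0 0 0.
Proof.
case: x => a b c d.
rewrite qmulE /qmul /sqnormq /=; congr Quat; ring.
Qed.

End Quaternions.

Definition iq {R : realFieldType} : quat R := Quat 0 1 0 0.
Definition jq {R : realFieldType} : quat R := Quat 0 0 1 0.
Definition kq {R : realFieldType} : quat R := Quat 0 0 0 1.

Record unit_quat (R : realFieldType) :=
  UnitQuat { quat_of :> quat R; _ : sqnormq quat_of == 1 }.

Section UnitQuaternions.
Variable R : realFieldType.
Implicit Types u v : unit_quat R.

HB.instance Definition _ := [isSub for @quat_of R].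
HB.instance Definition _ := [Choice of unit_quat R by <:].

Lemma sqnorm_unit u : sqnormq u = 1. Proof. exact/eqP/(valP u). Qed.

Fact one_unit_subproof : sqnormq (1 : quat R) == 1.
Proof. by rewrite sqnormq1. Qed.
Fact mul_unit_subproof u v : sqnormq (quat_of u * quat_of v) == 1.
Proof. by rewrite sqnormqM !sqnorm_unit mul1r. Qed.
Fact inv_unit_subproof u : sqnormq (conjq u) == 1.
Proof. by rewrite sqnorm_conjq sqnorm_unit. Qed.

Definition one_unit := UnitQuat one_unit_subproof.
Definition mul_unit u v := UnitQuat (mul_unit_subproof u v).
Definition inv_unit u := UnitQuat (inv_unit_subproof u).

Lemma mul_unitA : associative mul_unit.
Proof. by move=> u v w; apply: val_inj; rewrite /= mulrA. Qed.
Lemma mul_1unit : left_id one_unit mul_unit.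
Proof. by move=> u; apply: val_inj; rewrite /= mul1r. Qed.
Lemma mul_unit1 : right_id one_unit mul_unit.
Proof. by move=> u; apply: val_inj; rewrite /= mulr1. Qed.
Lemma mul_Vunit : left_inverse one_unit inv_unit mul_unit.
Proof.
by move=> u; apply: val_inj; rewrite /= mul_conjq sqnorm_unit.
Qed.
Lemma mul_unitV : right_inverse one_unit inv_unit mul_unit.
Proof.
by move=> u; apply: val_inj; rewrite /= qmul_conj sqnorm_unit.
Qed.

HB.instance Definition _ := isGroup.Build (unit_quat R)
  mul_unitA mul_1unit mul_unit1 mul_Vunit mul_unitV.

Lemma quat_of1 : quat_of (1%g : unit_quat R) = 1. Proof. by []. Qed.
Lemma quat_ofM u v : quat_of (u * v)%g = quat_of u * quat_of v.
Proof. by []. Qed.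
Lemma quat_ofV u : quat_of u^-1%g = conjq u. Proof. by []. Qed.

End UnitQuaternions.

Definition is_subgroup (G : groupType) (H : set G) : Prop :=
  [/\ H 1%g, forall x y, H x -> H y -> H (x * y)%g & forall x, H x -> H x^-1%g].

Definition generated_subgroup (G : groupType) (S : set G) : set G :=
  smallest (@is_subgroup G) S.

Section BinaryTetrahedral.
Variable R : realFieldType.

Fact gen_i_subproof : sqnormq (iq : quat R) == 1.
Proof. by apply/eqP; rewrite /sqnormq /=; ring. Qed.
Fact gen_w_subproof : sqnormq (2^-1 *: (- 1 + iq + jq + kq) : quat R) == 1.
Proof. by apply/eqP; rewrite /sqnormq /=; field. Qed.

Definition gen_i : unit_quat R := UnitQuat gen_i_subproof.
Definition gen_w : unit_quat R := UnitQuat gen_w_subproof.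

Definition binary_tetrahedral_set : set (unit_quat R) :=
  generated_subgroup [set u | u = gen_i \/ u = gen_w]%classic.

Record binary_tetrahedral := BinaryTetrahedral
  { unit_quat_of :> unit_quat R; _ : unit_quat_of \in binary_tetrahedral_set }.

HB.instance Definition _ := [isSub for unit_quat_of].
HB.instance Definition _ := [Choice of binary_tetrahedral by <:].

Lemma is_subgroup_tetrahedral : is_subgroup binary_tetrahedral_set.
Proof.
split=> [H [[]]//|x y Hx Hy H HH|x Hx H HH].
  by case: (HH) => -[_ HM _] _; apply: HM; [apply: Hx|apply: Hy].
by case: (HH) => -[_ _ HV] _; apply: HV; apply: Hx.
Qed.

Fact tetrahedral_group_closed : group_closed (mem binary_tetrahedral_set).
Proof.
have [T1 TM TV] := is_subgroup_tetrahedral.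
split=> [|x y]; rewrite ?inE //= => Hx Hy.
by apply: TM => //; apply: TV.
Qed.

HB.instance Definition _ :=
  SubChoice_isSubGroup.Build (unit_quat R) _ binary_tetrahedral
    tetrahedral_group_closed.

Definition zquat : Type := (int * int * int * int)%type.
Definition half_quat (z : zquat) : quat R :=
  let: (a, b, c, d) := z in 2^-1 *: Quat a%:~R b%:~R c%:~R d%:~R.
Definition zmulq (x y : zquat) : zquat :=
  let: (a, b, c, d) := x in let: (a', b', c', d') := y in
  (a * a' - b * b' - c * c' - d * d', a * b' + b * a' + c * d' - d * c',
   a * c' - b * d' + c * a' + d * b', a * d' + b * c' - c * b' + d * a').
Definition zdouble (x : zquat) : zquat :=
  let: (a, b, c, d) := x in (a + a, b + b, c + c, d + d).
Definition zconjq (x : zquat) : zquat :=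
  let: (a, b, c, d) := x in (a, - b, - c, - d).

Lemma half_quatM x y z : zmulq x y = zdouble z ->
  half_quat x * half_quat y = half_quat z.
Proof.
case: x y z => [[[a b] c] d] [[[a' b'] c'] d'] [[[a1 b1] c1] d1] /= [].
move=> /(congr1 (intr : int -> R)) Ea /(congr1 (intr : int -> R)) Eb.
move=> /(congr1 (intr : int -> R)) Ec /(congr1 (intr : int -> R)) Ed.
move: Ea Eb Ec Ed; rewrite !(rmorphD, rmorphB, rmorphM, rmorphN) /=.
move=> Ea Eb Ec Ed; rewrite qmulE !qscaleE /qmul /qscale /=; congr Quat.
- have -> : 2^-1 * a1%:~R = 2^-1 * 2^-1 * (a1%:~R + a1%:~R) :> R by field.
  by rewrite -Ea; field.
- have -> : 2^-1 * b1%:~R = 2^-1 * 2^-1 * (b1%:~R + b1%:~R) :> R by field.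
  by rewrite -Eb; field.
- have -> : 2^-1 * c1%:~R = 2^-1 * 2^-1 * (c1%:~R + c1%:~R) :> R by field.
  by rewrite -Ec; field.
- have -> : 2^-1 * d1%:~R = 2^-1 * 2^-1 * (d1%:~R + d1%:~R) :> R by field.
  by rewrite -Ed; field.
Qed.

Lemma half_quatV x : conjq (half_quat x) = half_quat (zconjq x).
Proof.
case: x => [[[a b] c] d]; rewrite /half_quat /= !qscaleE /conjq /qscale /=.
by rewrite !mulrNz !mulrN.
Qed.

Lemma half_quat_inj : injective half_quat.
Proof.
have h2 : 2^-1 != 0 :> R by rewrite invr_eq0 pnatr_eq0.
move=> [[[a b] c] d] [[[a' b'] c'] d'] [].
by do 4![move/(mulfI h2)/intr_inj->].
Qed.

(* The doubles of the 24 elements, each one (after the first three) being the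
   product of two earlier elements. *)
Definition tetrahedral_list : seq zquat := [::
  (2, 0, 0, 0); (0, 2, 0, 0); (-1, 1, 1, 1);
  (-2, 0, 0, 0); (-1, -1, -1, 1); (-1, -1, 1, -1); (-1, -1, -1, -1);
  (0, -2, 0, 0); (1, -1, -1, -1); (1, -1, 1, 1); (1, -1, 1, -1);
  (1, 1, -1, -1); (1, -1, -1, 1); (1, 1, 1, -1); (1, 1, -1, 1);
  (1, 1, 1, 1); (-1, 1, 1, -1); (-1, 1, -1, 1); (0, 0, 0, 2);
  (0, 0, 2, 0); (-1, 1, -1, -1); (-1, -1, 1, 1); (0, 0, -2, 0);
  (0, 0, 0, -2)].

Lemma tetrahedral_list_mul :
  all (fun x => all (fun y =>
    has (fun z => zmulq x y == zdouble z) tetrahedral_list)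
    tetrahedral_list) tetrahedral_list.
Proof. by vm_compute. Qed.

Lemma tetrahedral_list_conj :
  all (fun x => zconjq x \in tetrahedral_list) tetrahedral_list.
Proof. by vm_compute. Qed.

Lemma tetrahedral_list_gen :
  all (fun n => let z := nth (0, 0, 0, 0) tetrahedral_list n in
    has (fun x => has (fun y => zmulq x y == zdouble z)
                      (take 3 tetrahedral_list))
        (take n tetrahedral_list)) (iota 3 21).
Proof. by vm_compute. Qed.

Lemma half_quat1 : half_quat (2, 0, 0, 0) = 1.
Proof. by rewrite /half_quat /= !quatE /qscale /=; congr Quat; field. Qed.
Lemma half_quat_i : half_quat (0, 2, 0, 0) = gen_i.
Proof. by rewrite /half_quat /= !quatE /qscale /=; congr Quat; field. Qed.
Lemma half_quat_w : half_quat (-1, 1, 1, 1) = gen_w.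
Proof. by rewrite /half_quat /= !quatE /qscale /=; congr Quat; field. Qed.

Lemma tetrahedral_sub u : binary_tetrahedral_set u ->
  (u : quat R) \in map half_quat tetrahedral_list.
Proof.
pose H : set (unit_quat R) :=
  (fun u => (u : quat R) \in map half_quat tetrahedral_list).
move/(_ H); apply; split; last first.
  move=> v [] ->; rewrite /H ?(half_quat_i, half_quat_w).
    by rewrite -half_quat_i map_f.
  by rewrite -half_quat_w map_f.
split.
- by rewrite /H quat_of1 -half_quat1 map_f.
- move=> x y /mapP[a aL xa] /mapP[b bL yb].
  have /hasP[c cL /eqP abc] := allP (allP tetrahedral_list_mul _ aL) _ bL.
  by rewrite /H quat_ofM xa yb (half_quatM abc) map_f.
- move=> x /mapP[a aL xa].
  by rewrite /H quat_ofV xa half_quatV map_f // (allP tetrahedral_list_conj).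
Qed.

Lemma tetrahedral_sup z : z \in tetrahedral_list ->
  exists2 u, binary_tetrahedral_set u & (u : quat R) = half_quat z.
Proof.
have [T1 TM _] := is_subgroup_tetrahedral.
have Tgen x : x = gen_i \/ x = gen_w -> binary_tetrahedral_set x.
  by move=> xgen H [_]; apply.
suff IH n : (n <= 24)%N -> forall z, z \in take n tetrahedral_list ->
    exists2 u, binary_tetrahedral_set u & (u : quat R) = half_quat z.
  by move=> zL; apply: (IH 24%N).
elim: n => [//|n IHn] ltn24 {}z.
rewrite (take_nth (0, 0, 0, 0)) // mem_rcons inE => /predU1P[->|]; last first.
  by apply: IHn; apply: ltnW.
have [lt3n|le3n] := ltnP n 3.
  case: n lt3n {IHn ltn24} => [|[|[|//]]] _ /=.
  - by exists 1%g; rewrite // [RHS]half_quat1.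
  - by exists gen_i; rewrite -?half_quat_i //; apply: Tgen; left.
  - by exists gen_w; rewrite -?half_quat_w //; apply: Tgen; right.
have nI : n \in iota 3 21 by rewrite mem_iota le3n.
have /hasP[x xL /hasP[y yL /eqP xyz]] := allP tetrahedral_list_gen _ nI.
have [u Tu ux] := IHn (ltnW ltn24) _ xL.
have yL' : y \in take n tetrahedral_list.
  by rewrite -(subnKC le3n) takeD mem_cat yL.
have [v Tv vy] := IHn (ltnW ltn24) _ yL'.
by exists (u * v)%g; [apply: TM | rewrite [LHS]/= ux vy (half_quatM xyz)].
Qed.

Lemma mem_tetrahedral (u : unit_quat R) z : (u : quat R) = half_quat z ->
  z \in tetrahedral_list -> u \in binary_tetrahedral_set.
Proof.
move=> uz /tetrahedral_sup[v Tv vz]; rewrite inE.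
by have -> : u = v by apply: val_inj; rewrite /= uz.
Qed.

Definition tetrahedral_code (t : binary_tetrahedral) :
    seq_sub (map half_quat tetrahedral_list) :=
  SeqSub (tetrahedral_sub (set_mem (valP t))).
Definition tetrahedral_decode (q : seq_sub (map half_quat tetrahedral_list)) :
    option binary_tetrahedral :=
  obind insub (insub (ssval q) : option (unit_quat R)).
Lemma tetrahedral_codeK : pcancel tetrahedral_code tetrahedral_decode.
Proof. by move=> t; rewrite /tetrahedral_decode /= valK /= valK. Qed.

HB.instance Definition _ := PCanIsCountable tetrahedral_codeK.
HB.instance Definition _ : isFinite binary_tetrahedral :=
  PCanIsFinite tetrahedral_codeK.

Lemma card_binary_tetrahedral : #|{: binary_tetrahedral}| = 24%N.
Proof.
have inj_val : injective (fun t : binary_tetrahedral => quat_of (val t)).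
  by move=> s t /val_inj/val_inj.
rewrite cardT -(size_map (fun t : binary_tetrahedral => quat_of (val t))).
transitivity (size (map half_quat tetrahedral_list)); last by [].
apply/eqP; rewrite -uniq_size_uniq ?(map_inj_uniq inj_val) ?enum_uniq //.
  by rewrite (map_inj_uniq half_quat_inj).
move=> q; apply/mapP/mapP => [[z zL ->]|[t _ ->]].
  have [u Tu uz] := tetrahedral_sup zL.
  by exists (BinaryTetrahedral (mem_set Tu)); rewrite ?mem_enum.
by have /mapP := tetrahedral_sub (set_mem (valP t)).
Qed.

Fact omega0_subproof : sqnormq (2^-1 *: (1 + iq + jq + kq) : quat R) == 1.
Proof. by apply/eqP; rewrite /sqnormq /=; field. Qed.
Fact omegai_subproof : sqnormq (2^-1 *: (1 - iq + jq + kq) : quat R) == 1.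
Proof. by apply/eqP; rewrite /sqnormq /=; field. Qed.
Fact omegaj_subproof : sqnormq (2^-1 *: (1 + iq - jq + kq) : quat R) == 1.
Proof. by apply/eqP; rewrite /sqnormq /=; field. Qed.
Fact omegaij_subproof : sqnormq (2^-1 *: (1 - iq - jq + kq) : quat R) == 1.
Proof. by apply/eqP; rewrite /sqnormq /=; field. Qed.

Local Ltac mem_tetra z :=
  apply: (@mem_tetrahedral _ z); first
    [by rewrite /half_quat /= !quatE /qscale /=; congr Quat; field | by []].

Fact omega0_mem : UnitQuat omega0_subproof \in binary_tetrahedral_set.
Proof. by mem_tetra ((1, 1, 1, 1) : zquat). Qed.
Fact omegai_mem : UnitQuat omegai_subproof \in binary_tetrahedral_set.
Proof. by mem_tetra ((1, -1, 1, 1) : zquat). Qed.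
Fact omegaj_mem : UnitQuat omegaj_subproof \in binary_tetrahedral_set.
Proof. by mem_tetra ((1, 1, -1, 1) : zquat). Qed.
Fact omegaij_mem : UnitQuat omegaij_subproof \in binary_tetrahedral_set.
Proof. by mem_tetra ((1, -1, -1, 1) : zquat). Qed.

Definition omega0 : binary_tetrahedral := BinaryTetrahedral omega0_mem.
Definition omegai : binary_tetrahedral := BinaryTetrahedral omegai_mem.
Definition omegaj : binary_tetrahedral := BinaryTetrahedral omegaj_mem.
Definition omegaij : binary_tetrahedral := BinaryTetrahedral omegaij_mem.

End BinaryTetrahedral.

Arguments omega0 {R}.
Arguments omegai {R}.
Arguments omegaj {R}.
Arguments omegaij {R}.

Definition group_ring (G : finGroupType) : Type := {ffun G -> int}.

(* Z with the trivial action of G: a group ring element acts through its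
   augmentation. *)
Definition trivial_module (G : finGroupType) : Type := int.

Section GroupRing.
Variable G : finGroupType.
Implicit Types (a b c : group_ring G) (g h : G).

HB.instance Definition _ := GRing.Zmodule.copy (group_ring G) {ffun G -> int}.

Definition gr_elt g : group_ring G := [ffun h => (h == g)%:R].
Definition gr_mul a b : group_ring G :=
  [ffun g => \sum_(h : G) a h * b (h^-1 * g)%g].

Lemma gr_mulA : associative gr_mul.
Proof.
move=> a b c; apply/ffunP=> g; rewrite !ffunE.
under eq_bigr => h _ do rewrite ffunE mulr_sumr.
under [RHS]eq_bigr => h _ do rewrite ffunE mulr_suml.
rewrite [RHS]exchange_big; apply: eq_bigr => h _ /=.
rewrite (reindex_inj (mulgI h^-1%g)) /=; apply: eq_bigr => k _.
by rewrite invMg invgK mulrA -!mulgA mulKVg.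
Qed.

Lemma gr_mul1 : left_id (gr_elt 1%g) gr_mul.
Proof.
move=> a; apply/ffunP=> g; rewrite ffunE (bigD1 1%g) //= ffunE eqxx mul1r.
rewrite invg1 mul1g big1 ?addr0 // => h /negPf h1.
by rewrite ffunE h1 mul0r.
Qed.

Lemma gr_mulr1 : right_id (gr_elt 1%g) gr_mul.
Proof.
move=> a; apply/ffunP=> g; rewrite ffunE (bigD1 g) //= ffunE mulVg eqxx mulr1.
rewrite big1 ?addr0 // => h /negPf hg; rewrite ffunE.
by rewrite -eq_mulVg1 hg mulr0.
Qed.

Lemma gr_mulDl : left_distributive gr_mul +%R.
Proof.
move=> a b c; apply/ffunP=> g; rewrite !ffunE -big_split /=.
by apply: eq_bigr => h _; rewrite ffunE mulrDl.
Qed.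

Lemma gr_mulDr : right_distributive gr_mul +%R.
Proof.
move=> a b c; apply/ffunP=> g; rewrite !ffunE -big_split /=.
by apply: eq_bigr => h _; rewrite ffunE mulrDr.
Qed.

Lemma gr_elt1_neq0 : gr_elt 1%g != 0.
Proof. by apply/eqP=> /ffunP/(_ 1%g); rewrite !ffunE eqxx. Qed.

HB.instance Definition _ := GRing.Zmodule_isNzRing.Build (group_ring G)
  gr_mulA gr_mul1 gr_mulr1 gr_mulDl gr_mulDr gr_elt1_neq0.

Lemma gr_eltM g h : gr_elt g * gr_elt h = gr_elt (g * h)%g.
Proof.
apply/ffunP=> k; rewrite ffunE (bigD1 g) //= !ffunE eqxx mul1r.
rewrite big1 ?addr0 => [|x /negPf xg]; last by rewrite ffunE xg mul0r.
by rewrite -(inj_eq (mulgI g)) mulKVg.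
Qed.

Definition augmentation a : int := \sum_(g : G) a g.

Lemma augmentation_elt g : augmentation (gr_elt g) = 1.
Proof.
rewrite /augmentation (bigD1 g) //= ffunE eqxx big1 ?addr0 // => h /negPf hg.
by rewrite ffunE hg.
Qed.

Lemma augmentation_is_additive a b :
  augmentation (a + b) = augmentation a + augmentation b.
Proof.
by rewrite /augmentation -big_split; apply: eq_bigr => g _; rewrite ffunE.
Qed.

Lemma augmentationM a b :
  augmentation (a * b) = augmentation a * augmentation b.
Proof.
rewrite /augmentation; under eq_bigr => g _ do rewrite ffunE.
rewrite exchange_big mulr_suml; apply: eq_bigr => h _ /=.
rewrite (reindex_inj (mulgI h)) mulr_sumr; apply: eq_bigr => g _ /=.
by rewrite mulKg.
Qed.

HB.instance Definition _ := GRing.Zmodule.copy (trivial_module G) int.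

Definition trivial_scale a (n : trivial_module G) : trivial_module G :=
  augmentation a * (n : int).

Lemma trivial_scaleA a b n :
  trivial_scale a (trivial_scale b n) = trivial_scale (a * b) n.
Proof. by rewrite /trivial_scale augmentationM mulrA. Qed.
Lemma trivial_scale1 : left_id 1 trivial_scale.
Proof. by move=> n; rewrite /trivial_scale augmentation_elt mul1r. Qed.
Lemma trivial_scaleDr : right_distributive trivial_scale +%R.
Proof. by move=> a m n; rewrite /trivial_scale mulrDr. Qed.
Lemma trivial_scaleDl n : {morph trivial_scale^~ n : a b / a + b}.
Proof.
by move=> a b; rewrite /trivial_scale augmentation_is_additive mulrDl.
Qed.

HB.instance Definition _ :=
  GRing.Zmodule_isLmodule.Build (group_ring G) (trivial_module G)
    trivial_scaleA trivial_scale1 trivial_scaleDr trivial_scaleDl.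

(* The augmentation as a linear map out of Z[G]^1 (rows of length one). *)
Definition augmentation_map (v : 'rV[group_ring G]_1) : trivial_module G :=
  augmentation (v 0 0).

Lemma augmentation_map_linear : linear augmentation_map.
Proof.
move=> a u v; rewrite /augmentation_map !mxE augmentation_is_additive.
by rewrite augmentationM.
Qed.

HB.instance Definition _ :=
  GRing.isLinear.Build (group_ring G) 'rV[group_ring G]_1 (trivial_module G) _
    augmentation_map augmentation_map_linear.

End GroupRing.

Arguments gr_elt {G}.
Arguments augmentation_map {G}.

Definition is_basis (A : nzRingType) (F : lmodType A) (I : Type) (b : I -> F) :=
  (forall x : F, exists n (i : 'I_n -> I) (c : 'I_n -> A),
     x = \sum_k c k *: b (i k)) /\
  (forall n (i : 'I_n -> I) (c : 'I_n -> A), injective i ->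
     \sum_k c k *: b (i k) = 0 -> forall k, c k = 0).

Definition is_free (A : nzRingType) (F : lmodType A) : Prop :=
  exists (I : Type) (b : I -> F), is_basis b.

(* [d m] is the differential from degree m + 1 to degree m. *)
Definition is_free_resolution (A : nzRingType) (M : lmodType A)
    (F : nat -> lmodType A) (d : forall m, {linear F m.+1 -> F m})
    (eps : {linear F 0%N -> M}) : Prop :=
  [/\ forall m, is_free (F m),
      forall z : M, exists x : F 0%N, eps x = z,
      forall x : F 0%N, eps x = 0 <-> exists y : F 1%N, d 0%N y = x
    & forall m (x : F m.+1), d m x = 0 <-> exists y : F m.+2, d m.+1 y = x].

(* Equality of ranks and of matrices, not merely isomorphism of complexes. *)
Definition is_periodic (A : nzRingType) (p : nat) (rk : nat -> nat)
    (D : forall m, 'M[A]_(rk m.+1, rk m)) : Prop :=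
  forall m, exists e : (rk (m + p).+1 = rk m.+1) * (rk (m + p)%N = rk m),
    castmx e (D (m + p)%N) = D m.

Definition mx_of_seqs (A : nzRingType) m n (s : seq (seq A)) : 'M[A]_(m, n) :=
  \matrix_(i < m, j < n) nth 0 (nth [::] s i) j.

Section TetrahedralComplex.
Variable R : realFieldType.
Local Notation T := (binary_tetrahedral R).
Local Notation ZT := (group_ring T).
Local Notation w0 := (gr_elt omega0 : ZT).
Local Notation wi := (gr_elt omegai : ZT).
Local Notation wj := (gr_elt omegaj : ZT).
Local Notation wij := (gr_elt omegaij : ZT).

Definition tetra_d1 : 'M[ZT]_(4, 1) := mx_of_seqs 4 1
  [:: [:: wij - 1];
      [:: wj - 1];
      [:: w0 - 1];
      [:: wi - 1]].

Definition tetra_d2 : 'M[ZT]_(4, 4) := mx_of_seqs 4 4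
  [:: [:: w0; -1; 1; 0];
      [:: 0; wi; -1; 1];
      [:: 1; 0; wij; -1];
      [:: -1; 1; 0; wj]].

Definition tetra_d3 : 'M[ZT]_(1, 4) := mx_of_seqs 1 4
  [:: [:: 1 - wij; 1 - wj; 1 - w0; 1 - wi]].

Definition tetra_d4 : 'M[ZT]_(1, 1) := mx_of_seqs 1 1
  [:: [:: \sum_(g : T) gr_elt g]].

Fixpoint tetra_rank (m : nat) : nat :=
  match m with
  | 0 => 1 | 1 => 4 | 2 => 4 | 3 => 1
  | m'.+4 => tetra_rank m'
  end.

(* [tetra_mx m] is the matrix of the differential from degree m + 1 to
   degree m; the types match because [tetra_rank m.+4] reduces to
   [tetra_rank m]. *)
Fixpoint tetra_mx (m : nat) : 'M[ZT]_(tetra_rank m.+1, tetra_rank m) :=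
  match m with
  | 0 => tetra_d1 | 1 => tetra_d2 | 2 => tetra_d3 | 3 => tetra_d4
  | m'.+4 => tetra_mx m'
  end.

Definition tetra_module (m : nat) : lmodType ZT := 'rV[ZT]_(tetra_rank m).

Definition tetra_diff (m : nat) :
    {linear tetra_module m.+1 -> tetra_module m} := mulmxr (tetra_mx m).

End TetrahedralComplex.

Lemma tetra_rankE m :
  tetra_rank m = if (m %% 4)%N \in [:: 0; 3]%N then 1%N else 4%N.
Proof.
rewrite {1}(divn_eq m 4); elim: (m %/ 4)%N => [|n IHn].
  by have := ltn_pmod m (isT : 0 < 4)%N; case: (m %% 4)%N => [|[|[|[|]]]].
by rewrite mulSn -addnA.
Qed.

(* Main.v *)
Require Import Defs.
From mathcomp Require Import all_boot all_order all_fingroup all_algebra.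
From mathcomp Require Import boolp classical_sets reals.

Set Implicit Arguments.
Unset Strict Implicit.
Unset Printing Implicit Defensive.

Import GRing.Theory.
Local Open Scope ring_scope.

(** The matrices describe the cellular chain complex of the 24-cell, on which
    the group acts freely by left translation.  The vertices are the group
    elements; with w_0, w_1, w_2, w_3 = omega_ij, omega_j, omega_0, omega_i,
    the edges run from g to g w_k, the triangles come from the four relations
    w_(r+2) w_r = w_(r+1) (indices modulo 4), one row of the second
    differential each, and the 24 octahedra from the third differential.
    Since the boundary of the 24-cell is a 3-sphere, the complex is exact but
    for the homology in degrees 0 and 3, and the norm element splices
    successive copies of it together.

    All the topology is in [cocycle_is_coboundary]: the Cayley graph with its
    triangles is simply connected, so a 1-cocycle, with values in any abelian
    group modulo a subgroup, is a coboundary.  It is used twice.  For the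
    values e_k, modulo the image of the second differential, it makes every
    edge congruent to a difference of two potentials, so that a combination
    of edges with zero boundary is in that image ([tetra_exact1]).  For integer
    values it turns an element killed by the second differential, read as a
    function on edges, into the coboundary of a function on vertices, that is
    into a value of the third differential ([tetra_exact2]).

    In degree 0, the elements g - 1 span the augmentation ideal, and walking
    along generators puts each of them in the image of the first differential
    ([tetra_exact0]).  In degree 3, an element killed by the differential is
    invariant under right translation by the generators, hence constant on the
    group, hence a multiple of the norm ([tetra_exact3]); and multiplication
    by the norm has the same kernel as the augmentation, so that degree 4
    repeats degree 0. *)

(** * Reaching every edge of the Cayley graph from a spanning tree *)

Definition zquat1 : zquat := (2, 0, 0, 0).

(** The doubles of omega_ij, omega_j, omega_0, omega_i: the order of the entries
    of the first and third differentials, in which the four relations take the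
    uniform shape w_(r+2) w_r = w_(r+1). *)
Definition zomega (k : 'I_4) : zquat :=
  nth zquat1 [:: (1, -1, -1, 1); (1, 1, -1, 1); (1, 1, 1, 1); (1, -1, 1, 1)] k.

(** Right translation by a generator, as a search in the list because a
    product of doubles is the double of a double. *)
Definition zstep (z : zquat) (k : 'I_4) : zquat :=
  nth zquat1 tetrahedral_list
    (find (fun y => zmulq z (zomega k) == zdouble y) tetrahedral_list).

Definition zend (w : seq 'I_4) : zquat := foldl zstep zquat1 w.

(** An enumeration of the indices that evaluates to explicit ordinals, so that
    checks over it can be settled by computation. *)
Definition indices : seq 'I_4 := [seq inZp n | n <- iota 0 4].

Definition add_word (ws : seq (seq 'I_4)) (w : seq 'I_4) :=
  if zend w \in map zend ws then ws else rcons ws w.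

(** The words of a breadth-first spanning tree rooted at the identity; every
    group element is a product of at most four generators. *)
Definition spanning_tree : seq (seq 'I_4) :=
  iter 4 (fun ws => foldl add_word ws [seq rcons w k | w <- ws, k <- indices])
    [:: [::]].

Definition tree_path (z : zquat) : seq 'I_4 :=
  nth [::] spanning_tree (index z (map zend spanning_tree)).

Definition tree_edges : seq (zquat * 'I_4) :=
  [seq e <- [seq (z, k) | z <- tetrahedral_list, k <- indices] |
     tree_path (zstep e.1 e.2) == rcons (tree_path e.1) e.2].

(** The two paths w_(r+2), w_r and w_(r+1) from z to the same vertex. *)
Definition triangle (z : zquat) (r : 'I_4) : seq (zquat * 'I_4) :=
  [:: (z, r + 2); (zstep z (r + 2), r); (z, r + 1)].

(** A property of edges passed on from two sides of a triangle to the third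
    spreads from E to these edges. *)
Definition complete_triangles (E : seq (zquat * 'I_4)) :=
  undup (E ++ flatten
    [seq t <- [seq triangle z r | z <- tetrahedral_list, r <- indices] |
       (1 < count (mem E) t)%N]).

Definition reached_edges := iter 7 complete_triangles tree_edges.

Lemma mem_indices k : k \in indices.
Proof.
apply/mapP; exists (k : nat); rewrite ?valZpK // mem_iota /=.
by rewrite add0n ltn_ord.
Qed.

Lemma tree_path_end :
  all (fun z => zend (tree_path z) == z) tetrahedral_list.
Proof. by vm_compute. Qed.

(** This is the simple connectedness of the Cayley complex, in a form that a
    computation can decide: 73 edges outside the tree are gained triangle by
    triangle, and the seventh round exhausts them. *)
Lemma all_edges_reached :
  all (fun z => all (fun k => (z, k) \in reached_edges) indices)
    tetrahedral_list.
Proof. by vm_compute. Qed.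

Lemma mem_zomega k : zomega k \in tetrahedral_list.
Proof. by case: k => [[|[|[|[|//]]]] ltk]. Qed.

Lemma zstepP z k : z \in tetrahedral_list ->
  zmulq z (zomega k) = zdouble (zstep z k).
Proof.
move=> zL; have := allP (allP tetrahedral_list_mul _ zL) _ (mem_zomega k).
by move/(nth_find zquat1)/eqP.
Qed.

Lemma zomega_relation :
  all (fun r => zstep (zomega (r + 2)) r == zomega (r + 1)) indices.
Proof. by vm_compute. Qed.

Lemma mem_reached_edges z k : z \in tetrahedral_list ->
  (z, k) \in reached_edges.
Proof.
by move=> zL; apply: (allP (allP all_edges_reached _ zL)); apply: mem_indices.
Qed.

Section Cayley.
Variable R : realFieldType.
Local Notation T := (binary_tetrahedral R).

Definition omega (k : 'I_4) : T :=
  nth 1%g [:: omegaij; omegaj; omega0; omegai] k.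

(** Coordinates of a group element that can be computed with, whatever the
    field R. *)
Definition zquat_code (g : T) : zquat :=
  nth zquat1 tetrahedral_list
    (index (quat_of (val g)) (map (half_quat R) tetrahedral_list)).

Lemma mem_zquat_code g : zquat_code g \in tetrahedral_list.
Proof.
apply: mem_nth; rewrite -(size_map (half_quat R)) index_mem.
exact: tetrahedral_sub (set_mem (valP g)).
Qed.

Lemma zquat_codeK g : half_quat R (zquat_code g) = quat_of (val g).
Proof.
have gL := tetrahedral_sub (set_mem (valP g)).
rewrite -(nth_map _ (half_quat R zquat1)) ?nth_index //.
by rewrite -(size_map (half_quat R)) index_mem.
Qed.

Lemma zquat_code_inj : injective zquat_code.
Proof.
move=> g h gh.
do 2!apply: val_inj; transitivity (half_quat R (zquat_code g)).
  by rewrite zquat_codeK.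
by rewrite gh zquat_codeK.
Qed.

Lemma zquat_codeE g z : quat_of (val g) = half_quat R z -> zquat_code g = z.
Proof. by move=> gz; apply: (@half_quat_inj R); rewrite zquat_codeK. Qed.

Lemma zquat_code1 : zquat_code 1%g = zquat1.
Proof. by apply: zquat_codeE; rewrite half_quat1. Qed.

Lemma zquat_code_omega k : zquat_code (omega k) = zomega k.
Proof.
apply: zquat_codeE; rewrite /omega /zomega /half_quat.
case: k => [[|[|[|[|//]]]] ltk] /=; rewrite !quatE /qscale /=; congr Quat;
  by rewrite !(addr0, add0r, addNr, subr0, oppr0).
Qed.

Lemma zquat_code_surj z : z \in tetrahedral_list -> exists g, zquat_code g = z.
Proof.
case/(@tetrahedral_sup R)=> u Tu uz.
by exists (BinaryTetrahedral (mem_set Tu)); apply: zquat_codeE.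
Qed.

Lemma zquat_codeM g k : zquat_code (g * omega k)%g = zstep (zquat_code g) k.
Proof.
apply: zquat_codeE; rewrite -(half_quatM R (zstepP k (mem_zquat_code g))).
by rewrite zquat_codeK -zquat_code_omega zquat_codeK.
Qed.

Lemma omega_relation r : (omega (r + 2) * omega r)%g = omega (r + 1).
Proof.
apply: zquat_code_inj; rewrite zquat_codeM !zquat_code_omega.
exact/eqP/(allP zomega_relation)/mem_indices.
Qed.

Definition walk (g : T) (w : seq 'I_4) : T :=
  foldl (fun h k => h * omega k)%g g w.

Definition tree_word (g : T) := tree_path (zquat_code g).

Lemma walk_tree_word g : walk 1%g (tree_word g) = g.
Proof.
apply: zquat_code_inj.
have -> w : zquat_code (walk 1%g w) = zend w.
  elim/last_ind: w => [|w k IHw]; first exact: zquat_code1.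
  by rewrite /walk /zend !foldl_rcons zquat_codeM IHw.
exact/eqP/(allP tree_path_end)/mem_zquat_code.
Qed.

Lemma omega_ind (P : T -> Prop) :
  P 1%g -> (forall g k, P g -> P (g * omega k)%g) -> forall g, P g.
Proof.
move=> P1 PM g; rewrite -(walk_tree_word g).
elim/last_ind: (tree_word g) => [//|w k IHw].
by rewrite /walk foldl_rcons; apply: PM.
Qed.

(** The computation of [all_edges_reached] as an induction principle on the
    edges (g, k) of the Cayley graph. *)
Lemma edge_ind (P : T -> 'I_4 -> Prop) :
    (forall g k, tree_word (g * omega k)%g = rcons (tree_word g) k -> P g k) ->
    (forall g r (a := P g (r + 2)) (b := P (g * omega (r + 2))%g r)
       (c := P g (r + 1)), [/\ a -> b -> c, b -> c -> a & a -> c -> b]) ->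
  forall g k, P g k.
Proof.
move=> Ptree Ptriangle g k.
suff: forall e, e \in reached_edges -> forall h, zquat_code h = e.1 -> P h e.2.
  by move/(_ _ (mem_reached_edges k (mem_zquat_code g))); apply.
rewrite /reached_edges; elim: 7%N => [|n IHn] e.
  rewrite mem_filter => /andP[/eqP ek _] h he; apply: Ptree.
  by rewrite /tree_word zquat_codeM he.
rewrite iterS; move: (iter n _ _) IHn => E PE.
rewrite mem_undup mem_cat => /orP[/PE//|].
case/flattenP=> t; rewrite mem_filter => /andP[two].
case/allpairsP=> [[z r] [zL _ tE]]; case: (zquat_code_surj zL) => h hz.
have {}tE : t = triangle (zquat_code h) r by rewrite hz.
rewrite {t}tE /triangle -zquat_codeM in two *.
have [abc bca acb] := Ptriangle h r.
have {two}: [/\ P h (r + 2), P (h * omega (r + 2))%g r & P h (r + 1)].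
  move: two => /=.
  case aE: (_ \in E); case bE: (_ \in E); case cE: (_ \in E) => // _.
  - by split; [apply: (PE _ aE) | apply: (PE _ bE) | apply: (PE _ cE)].
  - have a := PE _ aE _ erefl; have b := PE _ bE _ erefl.
    by split; last exact: abc.
  - have a := PE _ aE _ erefl; have c := PE _ cE _ erefl.
    by split=> //; apply: acb.
  - have b := PE _ bE _ erefl; have c := PE _ cE _ erefl.
    by split=> //; apply: bca.
by case=> a b c; rewrite !inE => /or3P[] /eqP-> h' /zquat_code_inj->.
Qed.

(* Unification would otherwise try to evaluate the spanning tree. *)
#[local] Opaque spanning_tree tree_path.

Section Cocycle.
Variables (V : zmodType) (I : V -> Prop).
Hypotheses (I0 : I 0) (IB : forall x y, I x -> I y -> I (x - y)).
Variable f : 'I_4 -> T -> V.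
Hypothesis f_cocycle : forall g r,
  I (f (r + 2) g + f r (g * omega (r + 2))%g - f (r + 1) g).

Fixpoint word_sum (g : T) (w : seq 'I_4) : V :=
  if w is k :: w' then f k g + word_sum (g * omega k)%g w' else 0.

Lemma word_sum_rcons g w k :
  word_sum g (rcons w k) = word_sum g w + f k (walk g w).
Proof.
by elim: w g => [|l w IHw] g /=; rewrite ?addr0 ?add0r // IHw addrA.
Qed.

(** Summing the cocycle along the tree path from the identity forces the
    coboundary equation on tree edges. *)
Lemma exists_tree_potential : exists F : T -> V, forall g k,
  tree_word (g * omega k)%g = rcons (tree_word g) k ->
  F (g * omega k)%g = F g + f k g.
Proof.
exists (fun g => word_sum 1%g (tree_word g)) => g k wordE.
have tree_step w : walk 1%g w = g ->
    word_sum 1%g (rcons w k) = word_sum 1%g w + f k g.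
  by move=> wg; rewrite word_sum_rcons wg.
exact: etrans (congr1 (word_sum 1%g) wordE) (tree_step _ (walk_tree_word g)).
Qed.

(** Vanishing of the first cohomology of the Cayley complex.  The failure of
    the tree potential F to integrate f on an edge adds up along triangles,
    because f is a cocycle; so it lies in I for the third side of a triangle
    as soon as it does for two, and [edge_ind] starts from the tree.  Taking
    values modulo I amounts to coefficients in the quotient V / I. *)
Lemma cocycle_is_coboundary :
  exists F : T -> V, forall g k, I (F (g * omega k)%g - F g - f k g).
Proof.
have IN x : I x -> I (- x) by move=> Ix; rewrite -sub0r; apply: IB.
have ID x y : I x -> I y -> I (x + y).
  by move=> Ix Iy; rewrite -[y]opprK; apply/IB/IN.
have [F Ftree] := exists_tree_potential.
exists F; apply: edge_ind => [g k /Ftree->|g r].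
  by rewrite [F g + _]addrC addrK subrr.
have := IN _ (f_cocycle g r); rewrite -mulgA omega_relation.
move: (f (r + 2) g) (f r _) (f (r + 1) g) => x y z Ixyz.
move: (F (g * omega (r + 2))%g) (F (g * omega (r + 1))%g) (F g) => b c a.
(* The potentials telescope around the triangle. *)
have {Ixyz} Isum : I (b - a - x + (c - b - y) - (c - a - z)).
  move: Ixyz; congr I; rewrite addrACA -opprD [b - a + _]addrC subrKA.
  by rewrite 2!opprB [RHS]addrC subrKA.
split=> Ix Iy.
- by have := ID _ _ (IN _ Isum) (ID _ _ Ix Iy); rewrite opprB subrK.
- have := ID _ _ Isum (IB Iy Ix).
  by rewrite addrA subrK addrK.
- have := IB (ID _ _ Isum Iy) Ix.
  by rewrite subrK [_ - x + _]addrC addrK.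
Qed.

End Cocycle.

End Cayley.

(** * Integral group rings and free modules *)

Section GroupRing.
Variable G : finGroupType.
Implicit Types (a b : group_ring G) (g h : G).

Lemma gr_addE a b g : (a + b) g = a g + b g.
Proof. by rewrite ffunE. Qed.

Lemma gr_oppE a g : (- a) g = - a g.
Proof. by rewrite ffunE. Qed.

Lemma gr_zeroE g : (0 : group_ring G) g = 0.
Proof. by rewrite ffunE. Qed.

(** Pointwise evaluation of the additive operations only: [ffunE] would also
    unfold products. *)
Definition gr_zmodE := (gr_addE, gr_oppE, gr_zeroE).

Lemma gr_mul_eltE a g h : (a * gr_elt g) h = a (h * g^-1)%g.
Proof.
rewrite ffunE (bigD1 (h * g^-1)%g) //= ffunE invMg invgK mulgKV eqxx mulr1.
rewrite big1 ?addr0 // => k; rewrite ffunE.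
by case: (_ =P g) => [<-|]; rewrite ?mulr0 // invMg invgK mulKVg eqxx.
Qed.

Lemma gr_sum_elt a : a = \sum_g gr_elt g *~ a g.
Proof.
apply/ffunP=> h; rewrite sum_ffunE (bigD1 h) //= big1 => [|g /negPf gh].
  by rewrite ffunMzE ffunE eqxx addr0 intz.
by rewrite ffunMzE ffunE eq_sym gh mul0rz.
Qed.

(** The augmentation ideal is spanned by the differences g - 1: subtract
    the augmentation, which is zero, from the expansion of a. *)
Lemma gr_sum_sub1 a :
  augmentation a = 0 -> a = \sum_g (gr_elt g - 1) *~ a g.
Proof.
move=> a0; transitivity (a - 1 *~ augmentation a); first by rewrite a0 subr0.
rewrite [X in X - _]gr_sum_elt mulrz_sumr -sumrB.
by apply: eq_bigr => g _; rewrite mulrzBl.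
Qed.

Lemma gr_mul_norm a g : (a * \sum_h gr_elt h) g = augmentation a.
Proof.
rewrite mulr_sumr sum_ffunE /augmentation [RHS](reindex_inj (mulgI g)).
rewrite [LHS](reindex_inj invg_inj) /=.
by apply: eq_bigr => h _; rewrite gr_mul_eltE invgK.
Qed.

Lemma augmentation_eltz g (n : int) : augmentation (gr_elt g *~ n) = n.
Proof.
rewrite -[RHS]mul1r -(augmentation_elt g) /augmentation mulr_suml.
by apply: eq_bigr => h _; rewrite ffunMzE -mulrzr intz.
Qed.

Lemma augmentation_subr1 g : augmentation (gr_elt g - 1) = 0.
Proof.
apply: (@addIr _ (augmentation (gr_elt (1%g : G)))).
by rewrite -augmentation_is_additive subrK !augmentation_elt.
Qed.

End GroupRing.

Lemma rV_is_free (A : nzRingType) n : is_free 'rV[A]_n.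
Proof.
exists 'I_n, (fun k => delta_mx 0 k); split=> [x|m i c i_inj eq0 k].
  by exists n, id, (x 0); apply: row_sum_delta.
have /rowP/(_ (i k)) := eq0; rewrite summxE mxE (bigD1 k) //= big1 => [|l lk].
  by rewrite !mxE !eqxx mulr1 addr0.
by rewrite !mxE eqxx (inj_eq i_inj) eq_sym (negPf lk) mulr0.
Qed.

(** Started at the index of its row or column, a sum over the entries of the
    second differential looks the same for all rows and columns. *)
Lemma sum_I4_shift (V : nmodType) (F : 'I_4 -> V) r :
  \sum_k F k = F r + F (r + 1) + F (r + 2) + F (r + 3).
Proof.
rewrite (reindex_inj (addrI r)) !big_ord_recl big_ord0 -!(@addrA V) /=.
by rewrite [r + ord0]addr0; do ![congr (_ + _)]; rewrite ?addr0;
  congr (F (r + _)); apply: val_inj.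
Qed.

(** * Exactness and periodicity of the complex *)

Section Complex.
Variable R : realFieldType.
Local Notation T := (binary_tetrahedral R).
Local Notation ZT := (group_ring T).
Local Notation omega := (@omega R).

Lemma tetra_d1E k : tetra_d1 R k 0 = gr_elt (omega k) - 1.
Proof. by rewrite mxE; case: k => [[|[|[|[|//]]]]]. Qed.

Lemma tetra_d3E k : tetra_d3 R 0 k = 1 - gr_elt (omega k).
Proof. by rewrite mxE; case: k => [[|[|[|[|//]]]]]. Qed.

(** The second differential is cyclic up to its diagonal: the entry in row r
    and column r + j depends on r for j = 0 only. *)
Lemma tetra_d2_diag r : tetra_d2 R r r = gr_elt (omega (r + 2)).
Proof. by rewrite mxE; case: r => [[|[|[|[|//]]]]]. Qed.

Lemma tetra_d2_diag1 r : tetra_d2 R r (r + 1) = -1.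
Proof. by rewrite mxE; case: r => [[|[|[|[|//]]]]]. Qed.

Lemma tetra_d2_diag2 r : tetra_d2 R r (r + 2) = 1.
Proof. by rewrite mxE; case: r => [[|[|[|[|//]]]]]. Qed.

Lemma tetra_d2_diag3 r : tetra_d2 R r (r + 3) = 0.
Proof. by rewrite mxE; case: r => [[|[|[|[|//]]]]]. Qed.

(** The boundary of the triangle of w_(r+2) w_r = w_(r+1) at the identity. *)
Lemma row_tetra_d2 r : row r (tetra_d2 R) =
  gr_elt (omega (r + 2)) *: delta_mx 0 r - delta_mx 0 (r + 1)
  + delta_mx 0 (r + 2).
Proof.
rewrite [LHS]row_sum_delta (sum_I4_shift _ r) ![row _ _ 0 _]mxE tetra_d2_diag.
rewrite tetra_d2_diag1 tetra_d2_diag2 tetra_d2_diag3.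
by rewrite scale0r scale1r scaleN1r addr0.
Qed.

(** Column r + 2 involves the same relation w_(r+2) w_r = w_(r+1) as row r:
    this self-duality of the second differential is what lets the cocycle
    lemma also serve for its kernel. *)
Lemma mul_tetra_d2 n (x : 'M[ZT]_(n, 4)) i r : (x *m tetra_d2 R) i (r + 2) =
  x i (r + 2) * gr_elt (omega r) - x i (r + 1) + x i r.
Proof.
have r4 : r + 2 + 2 = r.
  by rewrite -addrA [2 + 2](_ : _ = 0) ?addr0 //; apply: val_inj.
have r13 : r + 2 = r + 1 + 1 by rewrite -addrA.
have r33 : r + 2 = r + 3 + 3 by rewrite -addrA; congr (r + _); apply: val_inj.
have d1 : tetra_d2 R (r + 1) (r + 2) = -1 by rewrite r13 tetra_d2_diag1.
have d3 : tetra_d2 R (r + 3) (r + 2) = 0 by rewrite r33 tetra_d2_diag3.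
rewrite mxE (sum_I4_shift _ r) tetra_d2_diag2 d1 tetra_d2_diag r4 d3.
by rewrite mulr1 mulrN1 mulr0 addr0 -addrA addrC [- _ + _]addrC.
Qed.

Lemma tetra_d2_d1 : tetra_d2 R *m tetra_d1 R = 0.
Proof.
apply/matrixP=> r j; rewrite ord1 mxE (sum_I4_shift _ r) tetra_d2_diag.
rewrite tetra_d2_diag1 tetra_d2_diag2 tetra_d2_diag3 !tetra_d1E mulrBr mulr1.
rewrite gr_eltM omega_relation mulN1r mul1r mul0r addr0 opprB.
by rewrite [_ - _ + (_ - _)]addrC !subrKA subrr mxE.
Qed.

Lemma tetra_d3_d2 : tetra_d3 R *m tetra_d2 R = 0.
Proof.
apply/matrixP=> i j; rewrite ord1 -[j](subrK 2) mul_tetra_d2 !tetra_d3E.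
rewrite mulrBl mul1r gr_eltM omega_relation opprB mxE.
by rewrite !subrKA subrr.
Qed.

Lemma tetra_d4_d3 : tetra_d4 R *m tetra_d3 R = 0.
Proof.
apply/matrixP=> i j; rewrite ord1 !mxE big_ord1 tetra_d3E mxE /=.
apply/ffunP=> g; rewrite mulrBr mulr1 !gr_zmodE gr_mul_eltE.
have normE (h : T) : (\sum_(k : T) gr_elt k : ZT) h = 1.
  by rewrite -[\sum_k _]mul1r gr_mul_norm augmentation_elt.
by rewrite !normE subrr.
Qed.

Lemma mul_tetra_d4_eq0 (x : 'rV[ZT]_1) :
  x *m tetra_d4 R = 0 <-> augmentation (x 0 0) = 0.
Proof.
split=> [/rowP/(_ 0) | x0].
  by rewrite mxE big_ord1 !mxE => /ffunP/(_ 1%g); rewrite gr_mul_norm gr_zeroE.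
apply/rowP=> j; rewrite ord1 mxE big_ord1 !mxE; apply/ffunP=> g.
by rewrite gr_mul_norm gr_zeroE.
Qed.

Lemma tetra_exact0 (x : 'rV[ZT]_1) :
  augmentation (x 0 0) = 0 <-> exists y, y *m tetra_d1 R = x.
Proof.
split=> [x0|[y <-]]; last first.
  have d1_0 k : augmentation (tetra_d1 R k 0) = 0.
    by rewrite tetra_d1E augmentation_subr1.
  rewrite mxE (sum_I4_shift _ 0) !augmentation_is_additive !augmentationM !d1_0.
  by rewrite !mulr0.
(* g w_k - 1 = (g - 1) + g (w_k - 1). *)
have diff g : exists y : 'rV[ZT]_4, (y *m tetra_d1 R) 0 0 = gr_elt g - 1.
  move: g; apply: omega_ind => [|g k [y yg]].
    by exists 0; rewrite mul0mx mxE subrr.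
  exists (y + gr_elt g *: delta_mx 0 k).
  rewrite mulmxDl mxE yg -scalemxAl -rowE [X in _ + X]mxE [X in _ * X]mxE.
  by rewrite tetra_d1E mulrBr gr_eltM mulr1 addrC; apply: subrKA.
have [y yP] := choice diff; exists (\sum_g (x 0 0 g)%:~R *: y g).
apply/rowP=> j; rewrite ord1 [RHS](gr_sum_sub1 x0) mulmx_suml summxE.
by apply: eq_bigr => g _; rewrite -scalemxAl mxE yP mulrzl.
Qed.

(** In the cokernel of d2, the edges g e_k form a cocycle, hence e_k at g is
    F(g w_k) - F(g) for some F.  Extending F additively, x becomes the value
    of F at x d1, which is zero. *)
Lemma tetra_exact1 (x : 'rV[ZT]_4) :
  x *m tetra_d1 R = 0 -> exists y, y *m tetra_d2 R = x.
Proof.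
move=> x0.
pose I (v : 'rV[ZT]_4) := exists y, y *m tetra_d2 R = v.
pose f k g : 'rV[ZT]_4 := gr_elt g *: delta_mx 0 k.
have I0 : I 0 by exists 0; rewrite mul0mx.
have IB u v : I u -> I v -> I (u - v).
  by move=> [a <-] [b <-]; exists (a - b); rewrite mulmxBl.
have fI g r : I (f (r + 2) g + f r (g * omega (r + 2))%g - f (r + 1) g).
  exists (gr_elt g *: delta_mx 0 r).
  rewrite -scalemxAl -rowE row_tetra_d2 /f -gr_eltM -scalerA.
  by rewrite -scalerDr -scalerBr; congr (_ *: _); rewrite addrC addrA.
have [F FI] := cocycle_is_coboundary I0 IB fI.
(* Y (g, k) witnesses the congruence on the edge (g, k); since the defect there
   is F(g w_k) - F(g) - g e_k, the preimage of x below has a minus sign. *)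
have [Y YE] := choice (fun p => FI p.1 p.2).
pose ext (a : ZT) := \sum_g F g *~ a g.
have extB a b : ext (a - b) = ext a - ext b.
  rewrite /ext -sumrB; apply: eq_bigr => g _.
  by rewrite gr_addE gr_oppE mulrzBr.
have ext_sum (c : 'I_4 -> ZT) : \sum_k ext (c k) = ext (\sum_k c k).
  rewrite exchange_big; apply: eq_bigr => g _ /=.
  by rewrite sum_ffunE mulrz_sumr.
have extM a h : ext (a * gr_elt h) = \sum_g F (g * h)%g *~ a g.
  rewrite /ext (reindex_inj (mulIg h)); apply: eq_bigr => g _ /=.
  by rewrite gr_mul_eltE mulgK.
have ext0 : \sum_k ext (x 0 k * gr_elt (omega k) - x 0 k) = 0.
  rewrite ext_sum; have /rowP/(_ 0) := x0; rewrite [LHS]mxE [RHS]mxE => x00.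
  rewrite (_ : \sum_k _ = 0); last first.
    by rewrite -[RHS]x00; apply: eq_bigr => k _; rewrite tetra_d1E mulrBr mulr1.
  by rewrite /ext big1 // => g _; rewrite gr_zeroE.
have Y_d2 k : (\sum_g Y (g, k) *~ x 0 k g) *m tetra_d2 R =
    ext (x 0 k * gr_elt (omega k) - x 0 k) - x 0 k *: delta_mx 0 k.
  rewrite extB extM [x 0 k in X in _ - X]gr_sum_elt scaler_suml mulmx_suml.
  rewrite -sumrB -sumrB; apply: eq_bigr => g _.
  rewrite -[LHS]/(mulmxr _ _) raddfMz /= YE /= -scalerMzl.
  by rewrite !mulrzBl.
exists (- \sum_k \sum_g Y (g, k) *~ x 0 k g).
rewrite mulNmx mulmx_suml (eq_bigr _ (fun k _ => Y_d2 k)) sumrB ext0.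
by rewrite sub0r opprK -row_sum_delta.
Qed.

(** The coefficients of x, that of g in the k-th entry being placed on the edge
    from g w_k^-1 to g, form an integral cocycle; the element of the group
    ring whose coefficients are given by a potential of it is the required
    preimage. *)
Lemma tetra_exact2 (x : 'rV[ZT]_4) :
  x *m tetra_d2 R = 0 -> exists y, y *m tetra_d3 R = x.
Proof.
move=> x0; pose f k g : int := x 0 k (g * omega k)%g.
have IB (u v : int) : u = 0 -> v = 0 -> u - v = 0.
  by move=> -> ->; rewrite subrr.
have fI g r : f (r + 2) g + f r (g * omega (r + 2))%g - f (r + 1) g = 0.
  have /rowP/(_ (r + 2)) := x0; rewrite mul_tetra_d2 mxE.
  move/ffunP/(_ (g * omega (r + 1))%g); rewrite !gr_zmodE gr_mul_eltE.
  rewrite -omega_relation mulgA mulgK => <-.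
  by rewrite /f -mulgA omega_relation addrAC.
have [F FI] := cocycle_is_coboundary erefl IB fI.
exists (const_mx [ffun g => F g]); apply/rowP=> k.
rewrite mxE big_ord1 mxE tetra_d3E mulrBr mulr1; apply/ffunP=> g.
rewrite !gr_zmodE gr_mul_eltE !ffunE.
have /eqP := FI (g * (omega k)^-1)%g k; rewrite mulgKV subr_eq0 => /eqP->.
by rewrite /f mulgKV.
Qed.

(** The equations x = x w_k say that the coefficients of x are invariant under
    right translation by generators, hence all equal to the coefficient of 1. *)
Lemma tetra_exact3 (x : 'rV[ZT]_1) :
  x *m tetra_d3 R = 0 -> exists y, y *m tetra_d4 R = x.
Proof.
move=> x0; exists (const_mx (gr_elt 1%g *~ x 0 0 1%g)).
apply/rowP=> j; rewrite ord1 mxE big_ord1 !mxE /=; apply/ffunP=> g.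
rewrite gr_mul_norm.
have -> : augmentation (gr_elt (1%g : T) *~ x 0 0 1%g) = x 0 0 1%g.
  exact: augmentation_eltz.
move: g; apply: omega_ind => // g k ->.
have /rowP/(_ k) := x0; rewrite mxE big_ord1 tetra_d3E mulrBr mulr1 mxE.
move/ffunP/(_ (g * omega k)%g); rewrite !gr_zmodE gr_mul_eltE mulgK => /eqP.
by rewrite subr_eq0 => /eqP.
Qed.

Lemma tetra_exact4 (x : 'rV[ZT]_1) :
  x *m tetra_d4 R = 0 <-> exists y, y *m tetra_d1 R = x.
Proof. exact: iff_trans (mul_tetra_d4_eq0 x) (tetra_exact0 x). Qed.

Lemma tetra_exact m (x : tetra_module R m.+1) :
  tetra_diff R m x = 0 <-> exists y, tetra_diff R m.+1 y = x.
Proof.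
move: m x; fix IHm 1; case=> [|[|[|[|m]]]] x.
- split; first exact: tetra_exact1.
  by case=> y <-; rewrite /= -mulmxA tetra_d2_d1 mulmx0.
- split; first exact: tetra_exact2.
  by case=> y <-; rewrite /= -mulmxA tetra_d3_d2 mulmx0.
- split; first exact: tetra_exact3.
  by case=> y <-; rewrite /= -mulmxA tetra_d4_d3 mulmx0.
- exact: tetra_exact4.
- exact: (IHm m x).
Qed.

Lemma tetra_periodic : is_periodic 4 (tetra_mx R).
Proof.
(* Ranks and matrices at 4 + m reduce to those at m, so no cast is left. *)
move=> m; rewrite addnC.
by exists (erefl, erefl); rewrite castmx_id.
Qed.

End Complex.

Theorem corollary6p3p2 (R : realType) :
  is_free_resolution (tetra_diff R)
    (augmentation_map :
       {linear tetra_module R 0 -> trivial_module (binary_tetrahedral R)})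
  /\ is_periodic 4 (tetra_mx R).
Proof.
split; last exact: tetra_periodic.
split=> [m|z|x|m x].
- exact: rV_is_free.
- exists (const_mx (gr_elt 1%g *~ z)).
  by rewrite /= /augmentation_map mxE; apply: augmentation_eltz.
- exact: tetra_exact0.
- exact: tetra_exact.
Qed.
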